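(* The ideals $I_{6,4}$, $I_{7,4}$ and $I_{7,6}$ are not radical. More precisely: (i) every coordinate of $SN_3(\mu)$ for $n=6$ lies in $\sqrt{I_{6,4}}$, but not all of these coordinates lie in $I_{6,4}$; (ii) for $n=7$ and $k\in\{4,6\}$, the square of the ideal generated by the coordinates of $J(\mu)$ and $SN_{k-1}(\mu)$ is contained in $I_{7,k}$, but not all coordinates of $SN_{k-1}(\mu)$ lie in $I_{7,k}$.
   Context: Let $\mathfrak{g}$ be a real vector space with basis $e_1,\dots,e_n$. Consider the polynomial ring over $\mathbb{R}$ in the variables $t_{i,j,k}$, $1\le i<j<k\le n$, and the generic ''triangular'' alternating bracket $\mu(e_i,e_j)=\sum_{k=j+1}^{n}t_{i,j,k}\,e_k$ for $i<j$ (every nilpotent Lie algebra admits a basis in which its bracket has this form). Define $J(\mu)(x,y,z)=\sum_{cyclic}\mu(\mu(x,y),z)$, $N_1(\mu)(x_1,x_2)=\mu(x_1,x_2)$, $N_k(\mu)(x_1,\dots,x_{k+1})=\mu(N_{k-1}(\mu)(x_1,\dots,x_k),x_{k+1})$, and for $k\ge3$, $SN_k(\mu)(x_1,\dots,x_{k+1})=\mu\big(\mu(x_1,x_2),N_{k-2}(\mu)(x_3,\dots,x_{k+1})\big)$. The ''coordinates'' of $J(\mu)$, $N_k(\mu)$, $SN_k(\mu)$ are the polynomials in the $t_{i,j,k}$ obtained by evaluating on basis vectors and taking coefficients in the basis $e_1,\dots,e_n$. $I_{n,k}$ denotes the ideal generated by the coordinates of $J(\mu)$ and of $N_k(\mu)$.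 *)

(* Defs.v *)
From HB Require Import structures.
From mathcomp Require Import all_boot all_order all_algebra.
From mathcomp Require Import boolp classical_sets reals.
From mathcomp Require Import mpoly.

Set Implicit Arguments.
Unset Strict Implicit.
Unset Printing Implicit Defensive.

Import GRing.Theory.
Local Open Scope classical_set_scope.
Local Open Scope ring_scope.

(* The library's [idealr_closed] only covers proper ideals given by boolean
   predicates; ideals are handled here as arbitrary subsets. *)
Section Ideals.
Variable A : comNzRingType.
Implicit Types (S I : set A).

Definition ideal_gen S : set A :=
  [set p | exists2 s : seq (A * A), (forall u, u \in s -> S u.2)
                                  & p = \sum_(u <- s) u.1 * u.2].

Definition ideal_mul I1 I2 : set A := ideal_gen [set p * q | p in I1 & q in I2].

Definition ideal_radical I : set A := [set p | exists2 m, (0 < m)%N & I (p ^+ m)].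

Definition is_radical I : Prop := ideal_radical I `<=` I.

End Ideals.

Section Brackets.
Variables (V : nmodType) (mu : V -> V -> V).

Definition jacobiator (x y z : V) : V :=
  mu (mu x y) z + mu (mu y z) x + mu (mu z x) y.

(* Arguments are numbered from 0: [Nop k x] is the (k+1)-ary operation N_k
   evaluated at x 0, ..., x k; later terms of the sequence are not used.
   Nop 0 x = x 0, so that Nop 1 x is convertible to mu (x 0) (x 1). *)
Fixpoint Nop (k : nat) (x : nat -> V) : V :=
  if k is k'.+1 then mu (Nop k' x) (x k) else x 0%N.

(* Meaningful for k >= 3, where it depends on x 0, ..., x k only. *)
Definition SNop (k : nat) (x : nat -> V) : V :=
  mu (mu (x 0%N) (x 1%N)) (Nop (k - 2) (fun a => x a.+2)).

End Brackets.

(* Index set of the variables t_{i,j,k}; indices are numbered from 0. *)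
Definition triple (n : nat) : Type :=
  {t : 'I_n * 'I_n * 'I_n | (t.1.1 < t.1.2)%N && (t.1.2 < t.2)%N}.
HB.instance Definition _ n := Finite.on (triple n).

Notation tpoly R n := {mpoly R[#|{: triple n}|]}.

Section Generic.
Variables (R : realType) (n : nat).
Local Notation P := (tpoly R n).
Local Notation V := 'rV[P]_n.
Local Notation e i := (delta_mx 0 i : V).

(* The variable t_{i,j,k} if i < j < k, and 0 otherwise. *)
Definition tvar (i j k : 'I_n) : P :=
  if insub (i, j, k) is Some t then 'X_(enum_rank (t : triple n)) else 0.

(* The generic bracket has polynomial coefficients, hence lives on the scalar
   extension of g to P, i.e. the free P-module with basis e_1, ..., e_n. *)
Definition mu (x y : V) : V :=
  \row_k \sum_i \sum_j x 0 i * y 0 j * (tvar i j k - tvar j i k).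

Definition coordJ : set P :=
  [set p | exists i j k l : 'I_n, p = jacobiator mu (e i) (e j) (e k) 0 l].

Definition coordN (k : nat) : set P :=
  [set p | exists (f : nat -> 'I_n) (l : 'I_n),
     p = Nop mu k (fun a => e (f a)) 0 l].

Definition coordSN (k : nat) : set P :=
  [set p | exists (f : nat -> 'I_n) (l : 'I_n),
     p = SNop mu k (fun a => e (f a)) 0 l].

Definition Iideal (k : nat) : set P := ideal_gen (coordJ `|` coordN k).

End Generic.

Arguments coordJ R n : clear implicits.
Arguments coordN R n k : clear implicits.
Arguments coordSN R n k : clear implicits.
Arguments Iideal R n k : clear implicits.

(* Sanity check: on basis vectors mu is the triangular alternating bracket. *)
Lemma mu_delta (R : realType) (n : nat) (i j k : 'I_n) :
  mu (delta_mx 0 i : 'rV[tpoly R n]_n) (delta_mx 0 j) 0 k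
    = tvar R i j k - tvar R j i k.
Proof.
rewrite mxE (bigD1 i) //= (bigD1 j) //= !mxE !eqxx !mul1r.
rewrite big1 ?addr0 => [|j' /negPf nj]; last by rewrite !mxE nj mulr0 mul0r.
rewrite big1 ?addr0 // => i' /negPf ni.
by apply: big1 => j' _; rewrite !mxE ni !mul0r.
Qed.

(* Main.v *)
Require Import Defs.
From mathcomp Require Import all_boot all_order all_algebra.
From mathcomp Require Import boolp classical_sets reals.
From mathcomp Require Import mpoly.
From HB Require Import structures.
From mathcomp Require Import ring.

Local Open Scope classical_set_scope.
Local Open Scope ring_scope.

(** In each of the three cases two facts are shown: a product of two
    coordinates of SN_(k-1) lies in I_(n,k), and some coordinate of SN_(k-1)
    does not.  The remaining claims are formal consequences: the squares put
    SN_(k-1) into the radical, and multiplying out sums gives the inclusion of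
    the squared ideal.

    Why products vanish modulo I is already visible for n = 6 (basis numbered
    from 1).  The e_6-coordinate s of [[e_1,e_2],[e_1,e_3]] is congruent to
    t_123 t_134 t_346, and the Jacobi identity on e_1, e_2, e_4 replaces
    t_123 t_346 by t_125 t_456 - t_145 t_256 + t_156 t_245.  As t_134 t_456
    is a Jacobi coordinate, s is also congruent to
    t_134 (t_156 t_245 - t_145 t_256).  Multiplying the two forms, every term
    of s^2 contains t_123 t_134 t_156 t_245 or t_123 t_134 t_145 t_256, two
    coordinates of N_4.  For n = 7 and k = 6 all N_6 are zero and the same role
    is played by cubic and quartic consequences of the Jacobi identities: the
    e_7-coordinate of [[e_1,e_2],[[[e_1,e_2],e_1],e_1]] is congruent to
    t_123^2 t_134 t_145 t_357, its square contains t_123 t_145 t_357^2, which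
    can be rewritten so that t_457 divides every term, and
    t_123 t_134 t_145 t_457 is in the ideal.

    For n = 7 there are many such rewritings, so they are found by
    computation: the bracket is evaluated on explicit sparse polynomials
    (vval_mu), Buchberger's algorithm, truncated in degree, turns the
    coordinates of J and N_k into rewriting rules that hold modulo I
    (buchberger_sound), and products of normal forms of SN coordinates are
    reduced to zero (coordSN_products).

    That a coordinate of SN_(k-1) is outside I is seen on a curve of brackets
    t_ijk = c X^d with coefficients in R[X]: on the chosen curves J and N_k
    vanish modulo X^3 while a coordinate of SN_(k-1) takes the value -X^2
    (coordSN_not_sub). *)

Set Implicit Arguments.
Unset Strict Implicit.
Unset Printing Implicit Defensive.

Import GRing.Theory.

(** * Ideals *)

Definition is_ideal (A : comNzRingType) (I : set A) : Prop :=
  [/\ I 0, forall x y, I x -> I y -> I (x + y) & forall a x, I x -> I (a * x)].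

Section IdealTheory.
Variable A : comNzRingType.
Implicit Types (S I : set A).

Lemma ideal_gen_is_ideal S : is_ideal (ideal_gen S).
Proof.
split=> [|x y [s sS ->] [t tS ->]|a x [s sS ->]].
- by exists [::]; rewrite ?big_nil.
- exists (s ++ t); last by rewrite big_cat.
  by move=> u; rewrite mem_cat => /orP[/sS|/tS].
- exists [seq (a * u.1, u.2) | u <- s]; first by move=> _ /mapP[u /sS Su ->].
  by rewrite big_map mulr_sumr; apply: eq_bigr => u _; rewrite /= mulrA.
Qed.

Lemma sub_ideal_gen S : S `<=` ideal_gen S.
Proof.
move=> x Sx; exists [:: (1, x)]; last by rewrite big_seq1 mul1r.
by move=> u; rewrite inE => /eqP ->.
Qed.

Lemma ideal_gen_min S I : is_ideal I -> S `<=` I -> ideal_gen S `<=` I.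
Proof.
move=> [I0 ID IM] SI _ [s sS ->]; rewrite big_seq.
by apply: (big_ind I) => // u /sS /SI Iu; apply: IM.
Qed.

Lemma ideal_opp I x : is_ideal I -> I x -> I (- x).
Proof. by move=> [_ _ IM] Ix; rewrite -mulN1r; apply: IM. Qed.

Lemma ideal_sub I x y : is_ideal I -> I x -> I y -> I (x - y).
Proof. by move=> II Ix Iy; have [_ ID _] := II; apply: ID => //; apply: ideal_opp. Qed.

Lemma ideal_mulr I x a : is_ideal I -> I x -> I (x * a).
Proof. by move=> [_ _ IM] Ix; rewrite mulrC; apply: IM. Qed.

Lemma ideal_mod I x y : is_ideal I -> I (x - y) -> I y -> I x.
Proof. by move=> [_ ID _] Ixy Iy; rewrite -(subrK y x); apply: ID. Qed.

Lemma ideal_mul_gen_sub S I : is_ideal I ->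
  (forall p q, S p -> S q -> I (p * q)) ->
  ideal_mul (ideal_gen S) (ideal_gen S) `<=` I.
Proof.
move=> II SSI; have [I0 ID IM] := II.
apply: ideal_gen_min => // _ [p Sp [q Sq <-]].
(* The colon ideal of B in I; used once for each of the two factors. *)
have colon (B : set A) : is_ideal [set x | forall y, B y -> I (x * y)].
  split=> [y _|x x' Ix Ix' y By|a x Ix y By].
  - by rewrite mul0r.
  - by rewrite mulrDl; apply: ID; [apply: Ix|apply: Ix'].
  - by rewrite -mulrA; apply/IM/Ix.
apply: (ideal_gen_min (colon _) _ Sp) Sq => x Sx y Sy; rewrite mulrC.
by apply: (ideal_gen_min (colon S) _ Sy) Sx => y' Sy' x' Sx'; apply: SSI.
Qed.

End IdealTheory.

(** * Computing with sparse polynomials *)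

(** The triple (i, j, k) stands for the variable t_ijk, indices from 0. *)
Definition var3 := (nat * nat * nat)%type.
(** A product of variables, listed in increasing order for vlt. *)
Definition smono := seq var3.
(** A sum of terms, listed by decreasing monomials; the first one leads. *)
Definition sparse := seq (int * smono).

(** The variables with the largest gap k - j are the smallest ones.  The choice
    matters: with it Buchberger's algorithm can be stopped in degree 5, after
    336 rules or fewer, and the normal forms of SN coordinates are short. *)
Definition vlt (u v : var3) : bool :=
  let: (i, j, k) := u in let: (i', j', k') := v in
  if (k - j == k' - j')%N then if i == i' then (j' < j)%N else (i' < i)%N
  else (k' - j' < k - j)%N.

(** On monomials of equal degree this is the graded reverse lexicographic
    order, because the smallest variable comes first in the lists. *)
Fixpoint mlt (m m' : smono) : bool :=
  match m, m' with
  | u :: s, v :: s' => if u == v then mlt s s' else vlt u v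
  | [::], _ :: _ => true
  | _, _ => false
  end.

Fixpoint mmul (m : smono) : smono -> smono :=
  fix mmul_m m' := match m, m' with
  | [::], _ => m'
  | _, [::] => m
  | u :: s, v :: s' => if vlt v u then v :: mmul_m s' else u :: mmul s m'
  end.

Fixpoint mdiv (m l : smono) : option smono :=
  match m, l with
  | _, [::] => Some m
  | [::], _ => None
  | u :: s, v :: l' => if u == v then mdiv s l' else omap (cons u) (mdiv s l)
  end.

Fixpoint mlcm (m : smono) : smono -> smono :=
  fix mlcm_m m' := match m, m' with
  | [::], _ => m'
  | _, [::] => m
  | u :: s, v :: s' => if u == v then u :: mlcm s s'
                       else if vlt v u then v :: mlcm_m s' else u :: mlcm s m'
  end.

Fixpoint padd (p : sparse) : sparse -> sparse :=
  fix padd_p q := match p, q with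
  | [::], _ => q
  | _, [::] => p
  | (c, m) :: p', (d, m') :: q' =>
    if m == m' then
      if c + d == 0 then padd p' q' else (c + d, m) :: padd p' q'
    else if mlt m m' then (d, m') :: padd_p q' else (c, m) :: padd p' q
  end.

Definition pscale (a : int) (m : smono) (p : sparse) : sparse :=
  [seq (a * t.1, mmul m t.2) | t <- p].

Definition pmul (p q : sparse) : sparse :=
  foldr (fun t => padd (pscale t.1 t.2 q)) [::] p.

Definition psub (p q : sparse) : sparse := padd p (pscale (-1) [::] q).

Section SparseEval.
Variables (A : comNzRingType) (x : var3 -> A).

Definition mval (m : smono) : A := \prod_(v <- m) x v.
Definition pval (p : sparse) : A := \sum_(t <- p) t.1%:~R * mval t.2.

Lemma mval_cons v m : mval (v :: m) = x v * mval m.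
Proof. exact: big_cons. Qed.

Lemma pval_cons t p : pval (t :: p) = t.1%:~R * mval t.2 + pval p.
Proof. exact: big_cons. Qed.

Lemma pval_nil : pval [::] = 0.
Proof. exact: big_nil. Qed.

Lemma mval_mul m m' : mval (mmul m m') = mval m * mval m'.
Proof.
elim: m m' => [|u s IHs] m'; first by rewrite /mval big_nil mul1r; case: m'.
elim: m' => [|v s' IHs'] /=; first by rewrite {3}/mval big_nil mulr1.
case: ifP => _; rewrite !mval_cons; first by rewrite IHs' mval_cons; ring.
by rewrite IHs mval_cons; ring.
Qed.

Lemma mval_div m l q : mdiv m l = Some q -> mval m = mval q * mval l.
Proof.
elim: m l q => [|u s IHs] [|v l] q //=.
- by case=> <-; rewrite /mval big_nil mul1r.
- by case=> <-; rewrite {3}/mval big_nil mulr1.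
case: eqP => [->|_].
  by move=> /IHs; rewrite !mval_cons => ->; ring.
case E: mdiv => [q'|//] [<-]; rewrite !mval_cons (IHs _ _ E) mval_cons; ring.
Qed.

Lemma pval_add p q : pval (padd p q) = pval p + pval q.
Proof.
elim: p q => [|[c m] p IHp] q; first by rewrite pval_nil add0r; case: q.
elim: q => [|[d m'] q IHq] /=; first by rewrite pval_nil addr0.
case: eqP => [->|_].
  have E : c%:~R * mval m' + pval p + (d%:~R * mval m' + pval q)
           = (c + d)%:~R * mval m' + (pval p + pval q) by rewrite rmorphD; ring.
  by case: eqP => [cd0|_]; rewrite !pval_cons /= E IHp // cd0 mul0r add0r.
by case: ifP => _; rewrite [LHS]pval_cons ?IHq ?IHp !pval_cons /=; ring.
Qed.

Lemma pval_scale a m p : pval (pscale a m p) = a%:~R * mval m * pval p.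
Proof.
rewrite /pval big_map mulr_sumr; apply: eq_bigr => t _ /=.
by rewrite mval_mul rmorphM; ring.
Qed.

Lemma pval_mul p q : pval (pmul p q) = pval p * pval q.
Proof.
elim: p => [|t p IHp] /=; first by rewrite pval_nil mul0r.
by rewrite pval_add IHp pval_scale pval_cons mulrDl.
Qed.

Lemma pval_sub p q : pval (psub p q) = pval p - pval q.
Proof. by rewrite pval_add pval_scale /mval big_nil mulr1 rmorphN mulN1r. Qed.

Lemma pval_foldr (T : Type) (F : T -> sparse) (s : seq T) :
  pval (foldr padd [::] [seq F t | t <- s]) = \sum_(t <- s) pval (F t).
Proof.
by elim: s => [|t s IHs] /=; rewrite ?big_nil ?pval_nil // pval_add IHs big_cons.
Qed.

End SparseEval.

(** * A truncated Buchberger algorithm *)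

(** The rule (l, t) rewrites the monomial l into t; it is sound when l - t is
    in the ideal. *)
Definition rule := (smono * sparse)%type.

Fixpoint find_rule (rs : seq rule) (m : smono) : option (smono * sparse) :=
  if rs is (l, t) :: rs' then
    if mdiv m l is Some q then Some (q, t) else find_rule rs' m
  else None.

(** The result is congruent to p in all cases: when the fuel is exhausted, what
    has not been treated is returned as it stands. *)
Fixpoint nf_rec (fuel : nat) (rs : seq rule) (p : sparse) : sparse :=
  if fuel is fuel'.+1 then
    if p is (c, m) :: p' then
      if find_rule rs m is Some (q, t) then
        nf_rec fuel' rs (padd (pscale c q t) p')
      else (c, m) :: nf_rec fuel' rs p'
    else [::]
  else p.

Definition nf := nf_rec (2 ^ 12).

(** The leading coefficient is divided out, which is legitimate modulo an ideal
    of a real polynomial ring; a polynomial with a coefficient that it does not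
    divide gives no rule, so that coefficients remain integers. *)
Definition add_rule (rs : seq rule) (p : sparse) : seq rule :=
  if nf rs p is (c, m) :: t then
    if (c != 0) && all (fun u => (c %| u.1)%Z) t
    then rcons rs (m, [seq (- (u.1 %/ c)%Z, u.2) | u <- t]) else rs
  else rs.

Definition spoly (r r' : rule) : sparse :=
  let l := mlcm r.1 r'.1 in
  if (mdiv l r.1, mdiv l r'.1) is (Some q, Some q') then
    psub (pscale 1 q r.2) (pscale 1 q' r'.2)
  else [::].

(** Pairs of rules whose S-polynomial is worth adding in degree d: each
    unordered pair is kept once, and pairs with coprime leading monomials are
    discarded, since their S-polynomials reduce to zero. *)
Definition critical (d : nat) (rr : rule * rule) : bool :=
  let: (r, r') := rr in
  [&& mlt r.1 r'.1, size (mlcm r.1 r'.1) == d & (d < size r.1 + size r'.1)%N].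

Definition sdeg (p : sparse) : nat := if p is (_, m) :: _ then size m else 0.

(** The generators are homogeneous, hence so are the rules, and a rule found in
    degree d only has critical pairs in higher degrees: one pass per degree is
    enough. *)
Definition buchberger_step (gens : seq sparse) (rs : seq rule) (d : nat) :=
  let rs' := foldl add_rule rs [seq g <- gens | sdeg g == d] in
  foldl add_rule rs' [seq spoly rr.1 rr.2 |
    rr <- [seq (r, r') | r <- rs', r' <- rs'] & critical d rr].

Definition buchberger (gens : seq sparse) (d : nat) : seq rule :=
  foldl (buchberger_step gens) [::] (iota 0 d.+1).

Section Soundness.
Variables (A : comNzRingType) (x : var3 -> A) (I : set A).
Hypothesis II : is_ideal I.
Hypothesis Idiv : forall (c : int) y, c != 0 -> I (c%:~R * y) -> I y.

Let sound (rs : seq rule) := forall r, r \in rs -> I (mval x r.1 - pval x r.2).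

Lemma find_rule_sound rs m q t : sound rs -> find_rule rs m = Some (q, t) ->
  I (mval x m - mval x q * pval x t).
Proof.
elim: rs => //= -[l u] rs IHrs rsI.
case E: mdiv => [q'|]; last first.
  by apply: IHrs => r r_rs; apply: rsI; rewrite inE r_rs orbT.
case=> <- <-; rewrite (mval_div _ E) -mulrBr; have [_ _ IM] := II.
by apply: IM; apply: (rsI (l, u)); rewrite mem_head.
Qed.

(** Each rewriting step subtracts a multiple of a relation l - t of I. *)
Lemma nf_sound rs p : sound rs -> I (pval x p - pval x (nf rs p)).
Proof.
rewrite /nf; move: (2 ^ 12)%N => fuel rsI; have [I0 ID IM] := II.
elim: fuel p => [|fuel IH] [|[c m] p] //=; rewrite ?subrr //.
case E: find_rule => [[q t]|].
  have := IH (padd (pscale c q t) p); rewrite pval_add pval_scale.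
  move/ID/(_ (IM c%:~R _ (find_rule_sound rsI E))); congr I.
  by rewrite pval_cons /=; ring.
by rewrite !pval_cons opprD addrACA subrr add0r.
Qed.

Lemma add_rule_sound rs p : sound rs -> I (pval x p) -> sound (add_rule rs p).
Proof.
move=> rsI Ip; rewrite /add_rule; have := nf_sound p rsI.
case: nf => [//|[c m] t] Inf; case: ifP => // /andP[c0 /allP ct] r.
rewrite mem_rcons inE => /orP[/eqP -> /=|]; last exact: rsI.
have := ideal_sub II Ip Inf; rewrite subKr pval_cons /=.
have -> : pval x t = c%:~R * pval x [seq ((u.1 %/ c)%Z, u.2) | u <- t].
  rewrite /pval big_map mulr_sumr big_seq [RHS]big_seq.
  apply: eq_bigr => u /ct /divzK {1}<- /=; rewrite rmorphM; ring.
rewrite -mulrDr => /(Idiv c0); congr I; congr (_ + _).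
rewrite /pval !big_map -sumrN; apply: eq_bigr => u _ /=.
by rewrite rmorphN mulNr opprK.
Qed.

Lemma foldl_add_rule_sound rs ps :
  sound rs -> (forall p, p \in ps -> I (pval x p)) ->
  sound (foldl add_rule rs ps).
Proof.
elim: ps rs => //= p ps IHps rs rsI psI; apply: IHps => [|q q_ps].
  by apply: add_rule_sound => //; apply: psI; rewrite mem_head.
by apply: psI; rewrite inE q_ps orbT.
Qed.

(** Both q l and q' l' are the least common multiple of the leading monomials
    l and l', so q t - q' t' is a combination of l - t and l' - t'. *)
Lemma spoly_sound rs r r' :
  sound rs -> r \in rs -> r' \in rs -> I (pval x (spoly r r')).
Proof.
move=> rsI /rsI Ir /rsI Ir'; rewrite /spoly; have [I0 _ IM] := II.
case E: mdiv => [q|]; last by rewrite pval_nil.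
case E': mdiv => [q'|]; last by rewrite pval_nil.
have := ideal_sub II (IM (mval x q') _ Ir') (IM (mval x q) _ Ir).
rewrite !mulrBr -(mval_div _ E) -(mval_div _ E') pval_sub !pval_scale.
by congr I; ring.
Qed.

Lemma buchberger_sound gens d :
  (forall p, p \in gens -> I (pval x p)) -> sound (buchberger gens d).
Proof.
move=> gensI; rewrite /buchberger; move: (iota 0 d.+1) => ds.
have: sound [::] by [].
elim: ds [::] => //= {}d ds IHds rs rsI; apply: IHds.
have rsI' : sound (foldl add_rule rs [seq g <- gens | sdeg g == d]).
  apply: foldl_add_rule_sound => // p; rewrite mem_filter => /andP[_].
  exact: gensI.
apply: foldl_add_rule_sound => // p /mapP[[r r']].
rewrite mem_filter => /andP[_ /allpairsP[[a b] [/= a_rs b_rs [-> ->]]]] ->.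
exact: spoly_sound rsI' a_rs b_rs.
Qed.

End Soundness.

(** * The generic bracket on coordinate lists *)

(** The list of the coordinates of a vector. *)
Definition svec := seq sparse.

(** The alternating bracket only involves t_ijk with i < j < k, so that each
    such variable multiplies the minor x_i y_j - x_j y_i. *)
Definition smu (n : nat) (x y : svec) : svec :=
  mkseq (fun k => foldr padd [::]
    [seq pscale 1 [:: (ij.1, ij.2, k)]
       (psub (pmul (nth [::] x ij.1) (nth [::] y ij.2))
             (pmul (nth [::] x ij.2) (nth [::] y ij.1)))
    | ij <- [seq (i, j) | j <- iota 0 k, i <- iota 0 j]]) n.

Definition sadd (n : nat) (x y : svec) : svec :=
  mkseq (fun k => padd (nth [::] x k) (nth [::] y k)) n.

Definition sbasis (n i : nat) : svec :=
  mkseq (fun k => if k == i then [:: (1, [::])] else [::]) n.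

Definition sjac (n i j k : nat) : svec :=
  let b := smu n in let e := sbasis n in
  sadd n (sadd n (b (b (e i) (e j)) (e k)) (b (b (e j) (e k)) (e i)))
         (b (b (e k) (e i)) (e j)).

Definition snonzero (v : svec) : bool := has (fun p => p != [::]) v.

Definition sjacs (n : nat) : seq svec :=
  [seq sjac n ij.1 ij.2 k | ij <- [seq (i, j) | i <- iota 0 n, j <- iota 0 n],
                            k <- iota 0 n].

(** Note the shift: svals n k lists values of N_(k+1) on basis vectors,
    including all nonzero ones up to sign.  Duplicates are removed at each
    stage to keep the lists short. *)
Fixpoint svals (n k : nat) : seq svec :=
  if k is k'.+1 then
    undup [seq v <- [seq smu n v (sbasis n a) | v <- svals n k', a <- iota 0 n]
          | snonzero v]
  else [seq smu n (sbasis n i) (sbasis n j) | j <- iota 0 n, i <- iota 0 j].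

(** The nonzero values of SN_(k+3), up to sign: a bracket of a value of N_1 and
    a value of N_(k+1). *)
Definition ssnvals (n k : nat) : seq svec :=
  undup [seq v <- [seq smu n v w | v <- svals n 0, w <- svals n k]
        | snonzero v].

Definition scoords (n : nat) (l : seq svec) : seq sparse :=
  undup [seq p <- [seq nth [::] v k | v <- l, k <- iota 0 n] | p != [::]].

(** The coordinates of J and of N_(k+1). *)
Definition sgens (n k : nat) : seq sparse :=
  scoords n (sjacs n) ++ scoords n (svals n k).

Lemma scoordsP n l p : p \in scoords n l ->
  exists v, exists2 k : 'I_n, v \in l & p = nth [::] v k.
Proof.
rewrite mem_undup mem_filter => /andP[_ /allpairsP[[v k] /= [vl + ->]]].
by rewrite mem_iota => kn; exists v; exists (Ordinal kn).
Qed.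

Lemma mem_scoords n (l : seq svec) v (k : 'I_n) : v \in l ->
  nth [::] v k = [::] \/ nth [::] v k \in scoords n l.
Proof.
move=> vl; rewrite mem_undup mem_filter.
case: eqVneq => [|_]; [by left|right].
by apply: (allpairs_f (fun v k => nth [::] v k)); rewrite ?mem_iota ?ltn_ord.
Qed.

Section SymbolicBracket.
Variables (R : realType) (n' : nat).
Local Notation n := n'.+1.
Local Notation P := (tpoly R n).
Local Notation V := 'rV[P]_n.
Local Notation e i := (delta_mx 0 i : V).
Local Notation mu := (@mu R n).

Definition tval (v : var3) : P :=
  let: (i, j, k) := v in
  if [&& i < j, j < k & k < n]%N then tvar R (inord i) (inord j) (inord k)
  else 0.

Definition vval (v : svec) : V := \row_k pval tval (nth [::] v k).

Lemma tvar_eq0 (i j k : 'I_n) : ~~ ((i < j)%N && (j < k)%N) -> tvar R i j k = 0.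
Proof. by move=> ijk; rewrite /tvar insubN. Qed.

Lemma muNC (x y : V) : mu x y = - mu y x.
Proof.
apply/rowP => k; rewrite !mxE exchange_big -sumrN /=; apply: eq_bigr => i _.
by rewrite -sumrN; apply: eq_bigr => j _; ring.
Qed.

Lemma mu0l (y : V) : mu 0 y = 0.
Proof.
apply/rowP => k; rewrite !mxE big1 // => i _.
by rewrite big1 // => j _; rewrite !mxE !mul0r.
Qed.

Lemma mu0r (x : V) : mu x 0 = 0.
Proof. by rewrite muNC mu0l oppr0. Qed.

Lemma muNl (x y : V) : mu (- x) y = - mu x y.
Proof.
apply/rowP => k; rewrite !mxE -sumrN; apply: eq_bigr => i _.
by rewrite -sumrN; apply: eq_bigr => j _; rewrite !mxE !mulNr.
Qed.

Lemma muNr (x y : V) : mu x (- y) = - mu x y.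
Proof. by rewrite muNC muNl -muNC. Qed.

(** Exchanging i and j in the part of the sum with a minus sign collects the
    minors; the terms left out have t_ijk = 0. *)
Lemma mu_ordered (x y : V) (k : 'I_n) : mu x y 0 k =
  \sum_(0 <= j < k) \sum_(0 <= i < j)
    (x 0 (inord i) * y 0 (inord j) - x 0 (inord j) * y 0 (inord i))
    * tval (i, j, val k).
Proof.
have -> : mu x y 0 k =
    \sum_(j < n) \sum_(i < n) (x 0 i * y 0 j - x 0 j * y 0 i) * tvar R i j k.
  rewrite mxE exchange_big /=.
  under eq_bigr do under eq_bigr do rewrite mulrBr.
  under eq_bigr do rewrite sumrB.
  under [RHS]eq_bigr do under eq_bigr do rewrite mulrBl.
  under [RHS]eq_bigr do rewrite sumrB.
  by rewrite !sumrB; congr (_ - _); rewrite exchange_big.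
rewrite (big_nat_widen _ _ n _ _ (ltnW (ltn_ord k))) big_mkord [RHS]big_mkcond.
apply: eq_bigr => j _ /=.
case: ifPn => [jk|kj]; last first.
  by apply: big1 => i _; rewrite tvar_eq0 ?mulr0 // (negPf kj) andbF.
rewrite (big_nat_widen _ _ n _ _ (ltnW (ltn_ord j))) big_mkord [RHS]big_mkcond.
apply: eq_bigr => i _ /=; case: ifPn => [ij|ji].
  by rewrite ij jk ltn_ord !inord_val.
by rewrite tvar_eq0 ?mulr0 // (negPf ji).
Qed.

Lemma vval_mu x y : vval (smu n x y) = mu (vval x) (vval y).
Proof.
apply/rowP => k; rewrite mu_ordered mxE nth_mkseq // pval_foldr big_allpairs_dep.
rewrite -[X in iota 0 X]subn0; apply: eq_big_seq => j.
rewrite mem_iota add0n subn0 => /andP[_ jk].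
rewrite -[X in iota 0 X]subn0; apply: eq_big_seq => i.
rewrite mem_iota add0n subn0 => /andP[_ ij].
have jn := ltn_trans jk (ltn_ord k); have inn := ltn_trans ij jn.
rewrite pval_scale pval_sub !pval_mul !mxE !inordK // mval_cons.
by rewrite /mval big_nil mulr1 mul1r mulrC.
Qed.

Lemma vval_add x y : vval (sadd n x y) = vval x + vval y.
Proof. by apply/rowP => k; rewrite !mxE nth_mkseq // pval_add. Qed.

Lemma vval_basis (i : 'I_n) : vval (sbasis n i) = e i.
Proof.
apply/rowP => k; rewrite !mxE nth_mkseq //= val_eqE.
by case: eqP => _; rewrite ?pval_nil // /pval big_seq1 /mval big_nil mulr1.
Qed.

Lemma vval_jac (i j k : 'I_n) :
  vval (sjac n i j k) = jacobiator mu (e i) (e j) (e k).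
Proof. by rewrite !vval_add !vval_mu !vval_basis. Qed.

Lemma vval_eq0 v : ~~ snonzero v -> vval v = 0.
Proof.
move=> /hasPn v0; apply/rowP => k; rewrite !mxE.
have [kv|vk] := ltnP k (size v); last by rewrite nth_default ?pval_nil.
by move: (v0 _ (mem_nth [::] kv)); rewrite negbK => /eqP ->; apply: pval_nil.
Qed.

Lemma eq_Nop k (x y : nat -> V) :
  (forall a, (a <= k)%N -> x a = y a) -> Nop mu k x = Nop mu k y.
Proof.
elim: k => [|k IHk] xy /=; first exact: xy.
by rewrite xy // IHk // => a ak; apply: xy; apply: leqW.
Qed.

(** The sign accounts for the order of the two innermost arguments of an
    iterated bracket, and zero for the values left out of the lists. *)
Definition listed (l : seq svec) (x : V) : Prop :=
  x = 0 \/ exists2 v, v \in l & exists b : bool, x = (-1) ^+ b *: vval v.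

Lemma listed_filter (l : seq svec) v (b : bool) :
  v \in l -> listed (undup [seq w <- l | snonzero w]) ((-1) ^+ b *: vval v).
Proof.
move=> vl; case: (boolP (snonzero v)) => [nz|/vval_eq0 ->].
  by right; exists v; [rewrite mem_undup mem_filter nz|exists b].
by left; rewrite scaler0.
Qed.

Lemma svals_listed k (f : nat -> 'I_n) :
  listed (svals n k) (Nop mu k.+1 (fun a => e (f a))).
Proof.
elim: k => [|k IHk].
  have pairs i j : (i < j < n)%N ->
      smu n (sbasis n i) (sbasis n j) \in svals n 0.
    move=> /andP[ij jn]; apply/allpairsPdep.
    by exists j, i; rewrite !mem_iota.
  rewrite /=; case: (ltngtP (f 0) (f 1)) => [f01|f10|f01].
  - right; exists (smu n (sbasis n (f 0)) (sbasis n (f 1))).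
      by apply: pairs; rewrite f01 ltn_ord.
    by exists false; rewrite scale1r vval_mu !vval_basis.
  - right; exists (smu n (sbasis n (f 1)) (sbasis n (f 0))).
      by apply: pairs; rewrite f10 ltn_ord.
    by exists true; rewrite scaleN1r vval_mu !vval_basis -muNC.
  - left; rewrite (ord_inj f01); apply/rowP => k.
    by rewrite mu_delta subrr mxE.
rewrite -[Nop mu _ _]/(mu (Nop mu k.+1 (fun a => e (f a))) (e (f k.+2))).
have {IHk} [->|[v v_vals [b ->]]] := IHk; first by left; rewrite mu0l.
have -> : mu ((-1) ^+ b *: vval v) (e (f k.+2)) =
    (-1) ^+ b *: vval (smu n v (sbasis n (f k.+2))).
  rewrite vval_mu vval_basis.
  by case: b; rewrite ?scaleN1r ?scale1r // muNl.
by apply: listed_filter; apply: (allpairs_f (fun v a => smu n v (sbasis n a)));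
  rewrite ?mem_iota ?ltn_ord.
Qed.

Lemma svals_Nop k v : v \in svals n k ->
  exists f : nat -> 'I_n, vval v = Nop mu k.+1 (fun a => e (f a)).
Proof.
elim: k v => [|k IHk] v.
  move=> /allpairsPdep[j [i [+ + ->]]]; rewrite !mem_iota /= => jn ij.
  have ni := ltn_trans ij jn.
  exists (fun a => if a == 0%N then Ordinal ni else Ordinal jn).
  by rewrite vval_mu -!vval_basis.
rewrite mem_undup mem_filter => /andP[_ /allpairsP[[w a] [wv + ->]]].
rewrite mem_iota => /= an; have [f Ef] := IHk w wv.
pose g b := if b == k.+2 then Ordinal an else f b; exists g.
rewrite -[RHS]/(mu (Nop mu k.+1 (fun b => e (g b))) (e (g k.+2))) vval_mu Ef.
congr (mu _ _); last by rewrite -vval_basis /g eqxx.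
by apply: eq_Nop => b bk; rewrite /g ltn_eqF.
Qed.

Lemma ssnvals_listed k (f : nat -> 'I_n) :
  listed (ssnvals n k) (SNop mu k.+3 (fun a => e (f a))).
Proof.
rewrite -[SNop _ _ _]/(mu (Nop mu 1 (fun a => e (f a)))
                          (Nop mu k.+1 (fun a => e (f a.+2)))).
have [->|[v v_vals [b ->]]] := svals_listed 0 f; first by left; rewrite mu0l.
have [->|[w w_vals [c ->]]] := svals_listed k (fun a => f a.+2).
  by left; rewrite mu0r.
have -> : mu ((-1) ^+ b *: vval v) ((-1) ^+ c *: vval w) =
    (-1) ^+ (b (+) c) *: vval (smu n v w).
  rewrite vval_mu; case: b; case: c;
  by rewrite ?scaleN1r ?scale1r ?muNl ?muNr ?opprK.
by apply: listed_filter; apply: (allpairs_f (smu n)).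
Qed.

Lemma ssnvals_SNop k v : v \in ssnvals n k ->
  exists f : nat -> 'I_n, vval v = SNop mu k.+3 (fun a => e (f a)).
Proof.
rewrite mem_undup mem_filter => /andP[_ /allpairsP[[u w] /= [uv wv ->]]].
have [f Ef] := @svals_Nop 0 u uv; have [g Eg] := svals_Nop wv.
exists (fun a => if a is a'.+2 then g a' else f a).
by rewrite vval_mu Ef Eg.
Qed.

Lemma sgens_coord k p : p \in sgens n k ->
  (coordJ R n `|` coordN R n k.+1) (pval tval p).
Proof.
rewrite mem_cat => /orP[] /scoordsP[v [l + ->]].
  move=> /allpairsP[[[i j] k'] [/allpairsP[[i' j'] [+ + [-> ->]]] + ->]].
  rewrite !mem_iota => /= i_n j_n k_n; left.
  exists (Ordinal i_n), (Ordinal j_n), (Ordinal k_n), l.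
  by rewrite -vval_jac mxE.
by move=> /svals_Nop[f Ef]; right; exists f, l; rewrite -Ef mxE.
Qed.

Lemma listed_coord (l : seq svec) x (i : 'I_n) : listed l x ->
  x 0 i = 0 \/ exists2 p, p \in scoords n l &
                 exists b : bool, x 0 i = (-1) ^+ b * pval tval p.
Proof.
case=> [->|[v vl [b ->]]]; first by left; rewrite mxE.
rewrite !mxE; have [->|p_l] := mem_scoords i vl.
  by left; rewrite pval_nil mulr0.
by right; exists (nth [::] v i) => //; exists b.
Qed.

Lemma coord_sgens k p : (coordJ R n `|` coordN R n k.+1) p ->
  p = 0 \/ exists2 q, q \in sgens n k & exists b : bool, p = (-1) ^+ b * pval tval q.
Proof.
case=> [[i [j [k' [l ->]]]]|[f [l ->]]].
  have : listed (sjacs n) (jacobiator mu (e i) (e j) (e k')).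
    right; exists (sjac n i j k'); last first.
      by exists false; rewrite scale1r vval_jac.
    apply/allpairsP; exists ((val i, val j), val k').
    split; rewrite ?mem_iota ?ltn_ord //.
    apply/allpairsP; exists (val i, val j).
    by split; rewrite ?mem_iota ?ltn_ord.
  move/(listed_coord l) => [->|[q ql qE]]; first by left.
  by right; exists q; rewrite // mem_cat ql.
have [->|[q ql qE]] := listed_coord l (svals_listed k f); first by left.
by right; exists q; rewrite // mem_cat ql orbT.
Qed.

End SymbolicBracket.

(** * Products of coordinates of SN *)

Definition residues (n k : nat) (rs : seq rule) : seq sparse :=
  undup [seq nf rs p | p <- scoords n (ssnvals n k)].

(** The finite computation behind the inclusion of products for SN_(k+3) and
    N_(k+4), with rules up to degree d. *)
Definition residue_products_vanish (n k d : nat) : bool :=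
  let rs := buchberger (sgens n k.+3) d in
  let s := residues n k rs in
  all (fun p => all (fun q => nf rs (pmul p q) == [::]) s) s.

Section Products.
Variables (R : realType) (n' : nat).
Local Notation n := n'.+1.
Local Notation pval := (pval (tval R n')).

(** The inverse of c is a constant polynomial. *)
Lemma Iideal_int_divisible k (c : int) (y : tpoly R n) :
  c != 0 -> Iideal R n k (c%:~R * y) -> Iideal R n k y.
Proof.
move=> c0 Icy; have [_ _ IM] := ideal_gen_is_ideal (coordJ R n `|` coordN R n k).
suff -> : y = (c%:~R^-1)%:MP * (c%:~R * y) by exact: IM.
rewrite mulrA -(rmorph_int (@mpolyC _ R)) -rmorphM /= mulVf ?mul1r //.
by rewrite intr_eq0.
Qed.

Lemma coordSN_listed k p : coordSN R n k.+3 p ->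
  p = 0 \/ exists2 q, q \in scoords n (ssnvals n k) &
             exists b : bool, p = (-1) ^+ b * pval q.
Proof. by case=> f [l ->]; apply/listed_coord/ssnvals_listed. Qed.

(** Modulo I both factors may be replaced by their normal forms, and the
    products of normal forms are among those that were reduced to zero. *)
Lemma coordSN_products k d : residue_products_vanish n k d ->
  forall p q, coordSN R n k.+3 p -> coordSN R n k.+3 q ->
  Iideal R n k.+4 (p * q).
Proof.
move=> /allP chk p q; set I := Iideal R n k.+4.
have II : is_ideal I := ideal_gen_is_ideal _; have [I0 ID IM] := II.
have Idiv := @Iideal_int_divisible k.+4.
move: chk; set rs := buchberger _ d => chk.
have rsI : forall r, r \in rs -> I (mval (tval R n') r.1 - pval r.2).
  apply: buchberger_sound => // g /sgens_coord gP.
  exact/sub_ideal_gen.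
move=> /coordSN_listed[->|[a a_sn [b ->]]]; first by rewrite mul0r.
move=> /coordSN_listed[->|[a' a'_sn [b' ->]]]; first by rewrite mulr0.
rewrite mulrACA; apply: (IM).
have nfP r := nf_sound II r rsI.
have res u : u \in scoords n (ssnvals n k) -> nf rs u \in residues n k rs.
  by move=> u_sn; rewrite mem_undup; apply: map_f.
apply: (ideal_mod (y := pval (nf rs a) * pval (nf rs a')) II).
  have -> : pval a * pval a' - pval (nf rs a) * pval (nf rs a') =
    pval a' * (pval a - pval (nf rs a)) +
    pval (nf rs a) * (pval a' - pval (nf rs a')) by ring.
  by apply: ID; apply: (IM).
rewrite -pval_mul.
have /allP/(_ _ (res _ a'_sn))/eqP nf0 := chk _ (res _ a_sn).
by have := nfP (pmul (nf rs a) (nf rs a')); rewrite nf0 pval_nil subr0.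
Qed.

End Products.

(** * Curves of brackets *)

(** An entry (v, (c, d)) prescribes the value c X^d for the variable v; the
    variables without entry take the value 0. *)
Definition arc := seq (var3 * (int * nat)).

Definition arc_var (n : nat) (a : arc) (v : var3) : int * nat :=
  let: (i, j, k) := v in
  if [&& i < j, j < k & k < n]%N
  then nth (0, 0%N) (unzip2 a) (index v (unzip1 a)) else (0, 0%N).

(** Coefficient and exponent of the value of a monomial on the curve. *)
Definition arc_mono (n : nat) (a : arc) (m : smono) : int * nat :=
  foldr (fun v u => ((arc_var n a v).1 * u.1, ((arc_var n a v).2 + u.2)%N))
    (1, 0%N) m.

(** The coefficient of X^b in the value of p on the curve. *)
Definition arc_coef (n : nat) (a : arc) (p : sparse) (b : nat) : int :=
  foldr (fun t s => if (arc_mono n a t.2).2 == b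
                    then t.1 * (arc_mono n a t.2).1 + s else s) 0 p.

(** On the curve the generators of the ideal vanish modulo X^3 and some
    coordinate of SN_(k+3) has a nonzero coefficient in degree 2. *)
Definition arc_separates (n k : nat) (a : arc) : bool :=
  all (fun p => all (fun b => arc_coef n a p b == 0) (iota 0 3)) (sgens n k.+3)
  && has (fun p => arc_coef n a p 2 != 0) (scoords n (ssnvals n k)).

Section Arcs.
Variables (R : realType) (n' : nat) (a : arc).
Local Notation n := n'.+1.

Definition arc_poly (v : var3) : {poly R} :=
  (arc_var n a v).1%:~R *: 'X^((arc_var n a v).2).

Definition arc_eval : tpoly R n -> {poly R} :=
  mmap (@polyC R) (fun s => let t := val (enum_val s : triple n) in
                            arc_poly (val t.1.1, val t.1.2, val t.2)).

HB.instance Definition _ := GRing.RMorphism.on arc_eval.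

Lemma arc_eval_tval v : arc_eval (tval R n' v) = arc_poly v.
Proof.
case: v => [[i j] k]; rewrite /tval.
case: ifP => [ijk|ijk]; last by rewrite rmorph0 /arc_poly /arc_var ijk scale0r.
have /and3P[ij jk kn] := ijk; have jn := ltn_trans jk kn.
have i_n := ltn_trans ij jn.
rewrite /tvar; case: insubP => [t _ tE|]; last by rewrite /= !inordK // ij jk.
by rewrite /arc_eval mmapX mmap1U enum_rankK tE /= !inordK.
Qed.

Lemma arc_eval_pval p : arc_eval (pval (tval R n') p) = pval arc_poly p.
Proof.
rewrite /pval rmorph_sum; apply: eq_bigr => t _.
rewrite rmorphM rmorph_int rmorph_prod; congr (_ * _).
by apply: eq_bigr => v _; apply: arc_eval_tval.
Qed.

Lemma arc_polyM m :
  mval arc_poly m = (arc_mono n a m).1%:~R *: 'X^((arc_mono n a m).2).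
Proof.
elim: m => [|v m IHm]; first by rewrite /mval big_nil scale1r expr0.
by rewrite mval_cons IHm -scalerAl -scalerAr scalerA -exprD -rmorphM.
Qed.

Lemma coef_arc_eval p b :
  (arc_eval (pval (tval R n') p))`_b = (arc_coef n a p b)%:~R.
Proof.
rewrite arc_eval_pval; elim: p => [|t p IHp]; first by rewrite pval_nil coef0.
rewrite pval_cons coefD IHp arc_polyM -(rmorph_int (@polyC R)) mul_polyC.
rewrite !coefZ coefXn /=; rewrite eq_sym.
case: eqP => _; last by rewrite !mulr0 add0r.
by rewrite mulr1 rmorphD rmorphM.
Qed.

(** This is the preimage of the ideal generated by X^d. *)
Lemma trunc_is_ideal d :
  is_ideal [set p : tpoly R n | forall b, (b < d)%N -> (arc_eval p)`_b = 0].
Proof.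
split=> [b _|p q Ip Iq b bd|p q Iq b bd] /=.
- by rewrite rmorph0 coef0.
- by rewrite rmorphD coefD Ip // Iq // addr0.
- rewrite rmorphM coefM big1 // => i _.
  by rewrite Iq ?mulr0 // (leq_ltn_trans (leq_subr _ _)).
Qed.

(** The preimage of the ideal generated by X^3 contains I but not all of SN. *)
Lemma coordSN_not_sub k : arc_separates n k a ->
  ~ (coordSN R n k.+3 `<=` Iideal R n k.+4).
Proof.
move=> /andP[/allP gens0 /hasP[p /scoordsP[v [l v_sn pE]] p2]] sub.
have [f Ef] := ssnvals_SNop R v_sn.
have pSN : coordSN R n k.+3 (pval (tval R n') p).
  by exists f, l; rewrite -Ef mxE -pE.
suff /eqP : (arc_eval (pval (tval R n') p))`_2 = 0.
  by rewrite coef_arc_eval intr_eq0 (negPf p2).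
apply: (ideal_gen_min (trunc_is_ideal 3) _ (sub _ pSN)) => // q.
move=> /coord_sgens[->|[g g_gens [s ->]]] b b3; first by rewrite rmorph0 coef0.
have b_in : b \in iota 0 3 by rewrite mem_iota.
have /allP/(_ b b_in)/eqP g0 := gens0 g g_gens.
by rewrite mulr_sign; case: s; rewrite ?rmorphN ?coefN coef_arc_eval g0 ?oppr0.
Qed.

End Arcs.

(** * The three ideals *)

Definition at_var (i j k : nat) (c : int) (d : nat) : var3 * (int * nat) :=
  ((i, j, k), (c, d)).
Arguments at_var (i j k)%_N c%_R d%_N.

(** In the basis numbered from 1: [e_1,e_2] = X e_3, [e_1,e_3] = e_4,
    [e_1,e_4] = X e_5, [e_2,e_5] = X e_6, [e_3,e_4] = - X e_6.  The Jacobi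
    identity holds exactly, the coordinates of N_4 are 0 or X^3 up to sign, and
    [[e_1,e_2],[e_1,e_3]] = - X^2 e_6. *)
Definition arc4 : arc :=
  [:: at_var 0 1 2 1 1; at_var 0 2 3 1 0; at_var 0 3 4 1 1; at_var 1 4 5 1 1;
      at_var 2 3 5 (-1) 1].

(** A deformation of a bracket in which e_1 shifts the basis except for
    [e_1,e_4] = X e_5.  The other brackets [e_2,e_5] = X e_6,
    [e_2,e_6] = 2 X e_7, [e_3,e_4] = - X^2 e_6 and [e_3,e_5] = - X e_7 solve
    the Jacobi identities involving e_1; those on e_2, e_3, e_4 hold up to
    terms of order X^3 only.  Here [[e_1,e_2],[[[e_1,e_2],e_1],e_1]] is equal
    to - X^2 e_7. *)
Definition arc6 : arc :=
  [:: at_var 0 1 2 1 0; at_var 0 2 3 1 0; at_var 0 3 4 1 1; at_var 0 4 5 1 0;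
      at_var 0 5 6 1 0; at_var 1 4 5 1 1; at_var 1 5 6 2 1;
      at_var 2 3 5 (-1) 2; at_var 2 4 6 (-1) 1].

(* The rules up to degree 4, 5 and 4, respectively, suffice to reduce the
   products to zero, although these have degrees 6, 6 and 10. *)
Lemma products64 : residue_products_vanish 6 0 4.
Proof. by vm_cast_no_check (erefl true). Qed.

Lemma products74 : residue_products_vanish 7 0 5.
Proof. by vm_cast_no_check (erefl true). Qed.

Lemma products76 : residue_products_vanish 7 2 4.
Proof. by vm_cast_no_check (erefl true). Qed.

Lemma separates64 : arc_separates 6 0 arc4.
Proof. by vm_cast_no_check (erefl true). Qed.

Lemma separates74 : arc_separates 7 0 arc4.
Proof. by vm_cast_no_check (erefl true). Qed.

Lemma separates76 : arc_separates 7 2 arc6.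
Proof. by vm_cast_no_check (erefl true). Qed.

Lemma coordSN_radical (R : realType) n' k d :
  residue_products_vanish n'.+1 k d ->
  coordSN R n'.+1 k.+3 `<=` ideal_radical (Iideal R n'.+1 k.+4).
Proof.
by move=> chk p pSN; exists 2%N => //; apply: (coordSN_products chk).
Qed.

Lemma Iideal_not_radical (R : realType) n' k d a :
  residue_products_vanish n'.+1 k d -> arc_separates n'.+1 k a ->
  ~ is_radical (Iideal R n'.+1 k.+4).
Proof.
move=> chk sep rad; apply: (coordSN_not_sub sep) => p pSN.
exact/rad/(coordSN_radical chk).
Qed.

Lemma SN_ideal_square (R : realType) n' k d :
  residue_products_vanish n'.+1 k d ->
  let SI := ideal_gen (coordJ R n'.+1 `|` coordSN R n'.+1 k.+3) in
  ideal_mul SI SI `<=` Iideal R n'.+1 k.+4.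
Proof.
move=> chk SI.
have II : is_ideal (Iideal R n'.+1 k.+4) := ideal_gen_is_ideal _.
apply: (ideal_mul_gen_sub II) => p q [Jp _|SNp [Jq|SNq]].
- by apply: (ideal_mulr q II); apply: sub_ideal_gen; left.
- by have [_ _ IM] := II; apply: IM; apply: sub_ideal_gen; left.
- exact: (coordSN_products chk).
Qed.

Theorem mainTheorem4 (R : realType) :
  [/\ ~ is_radical (Iideal R 6 4),
      ~ is_radical (Iideal R 7 4)
    & ~ is_radical (Iideal R 7 6)] /\
  (coordSN R 6 3 `<=` ideal_radical (Iideal R 6 4) /\
   ~ (coordSN R 6 3 `<=` Iideal R 6 4)) /\
  (forall k : nat, k = 4%N \/ k = 6%N ->
     let SI := ideal_gen (coordJ R 7 `|` coordSN R 7 (k - 1)) in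
     ideal_mul SI SI `<=` Iideal R 7 k /\
     ~ (coordSN R 7 (k - 1) `<=` Iideal R 7 k)).
Proof.
split; first split.
- exact: Iideal_not_radical products64 separates64.
- exact: Iideal_not_radical products74 separates74.
- exact: Iideal_not_radical products76 separates76.
split; first split.
- exact: coordSN_radical products64.
- exact: coordSN_not_sub separates64.
move=> k [] ->; split.
- exact: SN_ideal_square products74.
- exact: coordSN_not_sub separates74.
- exact: SN_ideal_square products76.
- exact: coordSN_not_sub separates76.
Qed.
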